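(* Let $m\in\mathbb N=\{1,2,\dots\}$, let $\lambda=(\lambda_1,\dots,\lambda_m)$ be a collection of mappings $\lambda_i:\{1,\dots,m\}\to\{1,\dots,m\}$, let $(X,d)$ be a complete $C$-distance space, let $F:X^m\to X$ be an operator, and suppose that $(X,d)$ is $(F,\lambda)$-bounded. 1. If $F$ is a $\lambda$-contraction, then every Picard sequence of the operator $\lambda F$ is a convergent Cauchy sequence and $F$ has a unique $\lambda$-multiple fixed point. 2. If $F$ is a $\bar\lambda$-contraction and, for every $i\in\{1,\dots,m\}$, the mapping $\lambda_i$ is a surjection or, more generally, $\left|\bigcup\{\lambda_i^{-1}(j): j\le m\}\right|=m$ for each $i\in\{1,\dots,m\}$, then every Picard sequence of the operator $\lambda F$ is a convergent Cauchy sequence and $F$ has a unique $\lambda$-multiple fixed point.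
   Context: A distance on a non-empty set $X$ is a mapping $d:X\times X\to\mathbb R$ with $d(x,y)\ge 0$ for all $x,y\in X$, and $d(x,y)+d(y,x)=0$ if and only if $x=y$ (neither symmetry nor a triangle inequality is assumed); $(X,d)$ is then a distance space. A sequence $\{x_n\}$ converges to $x$ if $\lim_{n\to\infty}d(x,x_n)=0$; it is convergent if it converges to some point of $X$; it is Cauchy if $\lim_{n,m\to\infty}d(x_n,x_m)=0$. $(X,d)$ is complete if every Cauchy sequence converges to some point of $X$. $(X,d)$ is a $C$-distance space if every convergent Cauchy sequence has a unique limit point. On $X^m$ consider the distances $d^m(x,y)=\sup\{d(x_i,y_i): i\le m\}$ and $\bar d^m(x,y)=\sum_{i=1}^m d(x_i,y_i)$, which have the same convergent sequences and the same Cauchy sequences; convergence and the Cauchy property in $X^m$ are understood with respect to these. The operator $\lambda F:X^m\to X^m$ is defined by $\lambda F(x_1,\dots,x_m)=(y_1,\dots,y_m)$ with $y_i=F(x_{\lambda_i(1)},\dots,x_{\lambda_i(m)})$ for $i=1,\dots,m$. A point $a\in X^m$ is a $\lambda$-multiple (multidimensional) fixed point of $F$ if $\lambda F(a)=a$, i.e. $a_i=F(a_{\lambda_i(1)},\dots,a_{\lambda_i(m)})$ for all $i$. For $a\in X^m$, the Picard sequence of $\lambda F$ at $a$ is $O(F,\lambda,a)=\{a(n):n\in\mathbb N\}$, where $a(1)=\lambda F(a)$ and $a(n+1)=\lambda F(a(n))$. $(X,d)$ is $(F,\lambda)$-bounded if for every $a\in X^m$ one has $\sup\{d^m(a,a(n))+d^m(a(n),a):n\in\mathbb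 N\}<\infty$. $F$ is a $\lambda$-contraction if there is $k\in[0,1)$ with $d(F(x_1,\dots,x_m),F(y_1,\dots,y_m))\le k\sup\{d(x_i,y_i):i\le m\}$ for all $(x_1,\dots,x_m),(y_1,\dots,y_m)\in X^m$. $F$ is a $\bar\lambda$-contraction if there is $k\in[0,1)$ with $d(F(x_1,\dots,x_m),F(y_1,\dots,y_m))\le \frac{k}{m}\sum_{i=1}^m d(x_i,y_i)$ for all $(x_1,\dots,x_m),(y_1,\dots,y_m)\in X^m$. *)

(* Defs.v *)
From mathcomp Require Import all_boot all_order all_algebra.
From mathcomp Require Import boolp classical_sets reals ereal topology.
From mathcomp Require Import normedtype sequences.

Set Implicit Arguments.
Unset Strict Implicit.
Unset Printing Implicit Defensive.

Import Order.TTheory GRing.Theory Num.Theory.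
Import numFieldNormedType.Exports.

Local Open Scope classical_set_scope.
Local Open Scope ring_scope.

Record distance_space (R : realType) (X : Type) (d : X -> X -> R) : Prop := {
  distance_inhabited : inhabited X;
  distance_ge0 : forall x y, 0 <= d x y;
  distance_eq0 : forall x y, d x y + d y x = 0 <-> x = y
}.

(* The limit point is the first argument of [d]; as [d] need not be
   symmetric, the order matters. *)
Definition converges_to (R : realType) (X : Type) (d : X -> X -> R)
    (u : nat -> X) (x : X) : Prop :=
  d x (u n) @[n --> \oo] --> (0 : R).

Definition convergent_seq (R : realType) (X : Type) (d : X -> X -> R)
    (u : nat -> X) : Prop :=
  exists x, converges_to d u x.

Definition cauchy_seq (R : realType) (X : Type) (d : X -> X -> R)
    (u : nat -> X) : Prop :=
  d (u nm.1) (u nm.2) @[nm --> (\oo, \oo)] --> (0 : R).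

Definition complete_distance (R : realType) (X : Type) (d : X -> X -> R)
    : Prop :=
  forall u : nat -> X, cauchy_seq d u -> convergent_seq d u.

Definition C_distance (R : realType) (X : Type) (d : X -> X -> R) : Prop :=
  forall u : nat -> X, convergent_seq d u -> cauchy_seq d u ->
    exists! x, converges_to d u x.

(* The distances d^m and \bar d^m on X^m. *)
Definition dist_sup (R : realType) (X : Type) (m : nat) (d : X -> X -> R)
    (x y : {ffun 'I_m -> X}) : R :=
  sup (range (fun i : 'I_m => d (x i) (y i))).

Definition dist_sum (R : realType) (X : Type) (m : nat) (d : X -> X -> R)
    (x y : {ffun 'I_m -> X}) : R :=
  \sum_(i < m) d (x i) (y i).

Definition lambda_op (X : Type) (m : nat) (lam : 'I_m -> 'I_m -> 'I_m)
    (F : {ffun 'I_m -> X} -> X) (x : {ffun 'I_m -> X}) : {ffun 'I_m -> X} :=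
  [ffun i => F [ffun j => x (lam i j)]].

Definition multiple_fixed_point (X : Type) (m : nat)
    (lam : 'I_m -> 'I_m -> 'I_m) (F : {ffun 'I_m -> X} -> X)
    (a : {ffun 'I_m -> X}) : Prop :=
  lambda_op lam F a = a.

(* Indexed from 0: [picard lam F a n] is the term a(n+1), so that
   the first term is a(1) = lambda F(a) and not a. *)
Definition picard (X : Type) (m : nat) (lam : 'I_m -> 'I_m -> 'I_m)
    (F : {ffun 'I_m -> X} -> X) (a : {ffun 'I_m -> X}) (n : nat)
    : {ffun 'I_m -> X} :=
  iter n.+1 (lambda_op lam F) a.

Definition F_lambda_bounded (R : realType) (X : Type) (m : nat)
    (d : X -> X -> R) (lam : 'I_m -> 'I_m -> 'I_m)
    (F : {ffun 'I_m -> X} -> X) : Prop :=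
  forall a : {ffun 'I_m -> X},
    (ereal_sup (range (fun n : nat =>
       (dist_sup d a (picard lam F a n) +
        dist_sup d (picard lam F a n) a)%:E)) < +oo)%E.

Definition lambda_contraction (R : realType) (X : Type) (m : nat)
    (d : X -> X -> R) (F : {ffun 'I_m -> X} -> X) : Prop :=
  exists k : R, 0 <= k < 1 /\
    forall x y : {ffun 'I_m -> X}, d (F x) (F y) <= k * dist_sup d x y.

Definition lambda_bar_contraction (R : realType) (X : Type) (m : nat)
    (d : X -> X -> R) (F : {ffun 'I_m -> X} -> X) : Prop :=
  exists k : R, 0 <= k < 1 /\
    forall x y : {ffun 'I_m -> X}, d (F x) (F y) <= k / m%:R * dist_sum d x y.

(* Main.v *)
(* Writing G for lambda F, both contraction conditions give
   d^m (G x) (G y) <= k * d^m x y; for the averaged one this is because a mean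
   is at most the maximum.
   Without a triangle inequality, boundedness of the Picard sequence replaces
   the usual geometric sum: d^m (G^n a) (G^p a) <= k^N * M as soon as
   n, p >= N, where M bounds d^m between a and its iterates.  Each coordinate
   sequence is thus Cauchy and converges.  If b is the limit, then G b is also
   a limit, so the C-property forces G b = b. *)
Require Import Defs.
From mathcomp Require Import all_boot all_order all_algebra.
From mathcomp Require Import boolp classical_sets reals ereal topology.
From mathcomp Require Import normedtype sequences.

Import Order.TTheory GRing.Theory Num.Theory.
Import numFieldNormedType.Exports.

Set Implicit Arguments.
Unset Strict Implicit.

Section DistSup.
Local Open Scope classical_set_scope.
Local Open Scope ring_scope.
Variables (R : realType) (X : Type) (d : X -> X -> R).
Hypothesis hd : distance_space d.

Lemma distxx (x : X) : d x x = 0.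
Proof.
have /(distance_eq0 hd) : x = x by [].
by move/eqP; rewrite paddr_eq0 ?(distance_ge0 hd)// => /andP[/eqP].
Qed.

Lemma dist_le_dist_sup (m : nat) (x y : {ffun 'I_m -> X}) (i : 'I_m) :
  d (x i) (y i) <= dist_sup d x y.
Proof.
apply: ub_le_sup; last by exists i.
(* A real [sup] dominates its set only when some bound exists; the sum of all coordinate distances
   is one. *)
exists (\sum_(j < m) d (x j) (y j)) => _ [j _ <-].
rewrite (bigD1 j)//= lerDl; apply: sumr_ge0 => l _.
exact: distance_ge0 hd _ _.
Qed.

(** For [m = 0] the supremum would be the default value [0], which a negative [c] does not bound. *)
Lemma dist_sup_le (m : nat) (x y : {ffun 'I_m -> X}) (c : R) : (0 < m)%N ->
  (forall i, d (x i) (y i) <= c) -> dist_sup d x y <= c.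
Proof.
move=> m0 le_c; apply: ge_sup => [|_ [i _ <-]//].
by exists (d (x (Ordinal m0)) (y (Ordinal m0))); exists (Ordinal m0).
Qed.

Lemma dist_sup_ge0 (m : nat) (x y : {ffun 'I_m -> X}) : (0 < m)%N ->
  0 <= dist_sup d x y.
Proof.
move=> m0; apply: le_trans (dist_le_dist_sup x y (Ordinal m0)).
exact: distance_ge0 hd _ _.
Qed.

Lemma converges_to_coord (m : nat) (u : nat -> {ffun 'I_m -> X}) x i :
  converges_to (dist_sup d) u x -> converges_to d (fun n => u n i) (x i).
Proof.
move=> ux; apply: (squeeze_cvgr _ (cvg_cst 0) ux).
by apply: nearW => n; rewrite (distance_ge0 hd) dist_le_dist_sup.
Qed.

Lemma cauchy_seq_coord (m : nat) (u : nat -> {ffun 'I_m -> X}) i :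
  cauchy_seq (dist_sup d) u -> cauchy_seq d (fun n => u n i).
Proof.
move=> cu; apply: (squeeze_cvgr _ (cvg_cst 0) cu).
by apply: nearW => n; rewrite (distance_ge0 hd) dist_le_dist_sup.
Qed.

Lemma converges_to_dist_sup (m : nat) (u : nat -> {ffun 'I_m -> X})
    (x : {ffun 'I_m -> X}) :
  (0 < m)%N -> (forall i, converges_to d (fun n => u n i) (x i)) ->
  converges_to (dist_sup d) u x.
Proof.
move=> m0 ux.
(* The supremum is squeezed between [0] and a finite sum of null sequences. *)
have : \sum_(i < m) d (x i) (u n i) @[n --> \oo] --> \sum_(i < m) (0 : R).
  by apply: (cvg_big add_continuous) => i _; exact: ux.
rewrite big1_eq => sum0.
apply: (squeeze_cvgr _ (cvg_cst 0) sum0); apply: nearW => n.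
rewrite dist_sup_ge0//= dist_sup_le// => i.
rewrite (bigD1 i)//= lerDl; apply: sumr_ge0 => j _.
exact: distance_ge0 hd _ _.
Qed.

Lemma lambda_bar_contractionW (m : nat) (F : {ffun 'I_m -> X} -> X) :
  (0 < m)%N -> lambda_bar_contraction d F -> lambda_contraction d F.
Proof.
move=> m0 [k [/andP[k0 k1] Fk]]; exists k; rewrite k0 k1; split=> // x y.
apply: le_trans (Fk x y) _; rewrite -mulrA ler_wpM2l//.
rewrite mulrC ler_pdivrMr ?ltr0n// mulr_natr.
rewrite -[X in _ *+ X]card_ord -sumr_const.
by apply: ler_sum => i _; exact: dist_le_dist_sup.
Qed.

End DistSup.

Section Picard.
Local Open Scope classical_set_scope.
Local Open Scope ring_scope.
Variables (R : realType) (m : nat) (lam : 'I_m -> 'I_m -> 'I_m) (X : Type).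
Variables (d : X -> X -> R) (F : {ffun 'I_m -> X} -> X) (k : R).
Hypotheses (m0 : (0 < m)%N) (hd : distance_space d) (k0 : 0 <= k) (k1 : k < 1).
Hypothesis Fk : forall x y, d (F x) (F y) <= k * dist_sup d x y.

Let G := lambda_op lam F.

(** Reindexing by [lam i] only repeats or drops coordinates, so it cannot increase the supremum
    distance. *)
Lemma lambda_op_contraction x y :
  dist_sup d (G x) (G y) <= k * dist_sup d x y.
Proof.
apply: dist_sup_le => // i; rewrite !ffunE.
apply: le_trans (Fk _ _) _; rewrite ler_wpM2l//.
by apply: dist_sup_le => // j; rewrite !ffunE; exact: dist_le_dist_sup.
Qed.

Lemma iter_lambda_op_contraction n x y :
  dist_sup d (iter n G x) (iter n G y) <= k ^+ n * dist_sup d x y.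
Proof.
elim: n => [|n IHn]; first by rewrite mul1r.
rewrite !iterS exprS -mulrA; apply: le_trans (lambda_op_contraction _ _) _.
by rewrite ler_wpM2l.
Qed.

Lemma multiple_fixed_point_uniq a b :
  multiple_fixed_point lam F a -> multiple_fixed_point lam F b -> a = b.
Proof.
have dist0 x y : G x = x -> G y = y -> dist_sup d x y <= 0.
  move=> Gx Gy; have := lambda_op_contraction x y; rewrite Gx Gy.
  (* The inequality [t <= k * t] becomes [0 <= (k - 1) * t] with [k - 1 < 0]. *)
  by rewrite -[leLHS]mul1r -subr_ge0 -mulrBl nmulr_rge0 ?subr_lt0.
move=> Ga Gb; apply/ffunP => i; apply/(distance_eq0 hd).
apply: le_anti; rewrite addr_ge0 ?(distance_ge0 hd)// andbT.
by rewrite -[leRHS]addr0 lerD// (le_trans (dist_le_dist_sup hd _ _ i))//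
  dist0.
Qed.

Hypothesis hbounded : F_lambda_bounded d lam F.

Lemma iter_lambda_op_bounded a : exists2 M : R, 0 < M & forall n,
  dist_sup d a (iter n G a) <= M /\ dist_sup d (iter n G a) a <= M.
Proof.
have := hbounded a; set S := ereal_sup _ => S_fin.
have S_ub n : ((dist_sup d a (picard lam F a n) +
    dist_sup d (picard lam F a n) a)%:E <= S)%E.
  by apply: ereal_sup_ubound; exists n.
(* Being above a real number, [S] is not [-oo], and [S_fin] excludes [+oo]. *)
have SE : S = (fine S)%:E.
  have := S_ub 0%N; by case: (S) S_fin => // _; rewrite leeNy_eq.
have sum_le n : dist_sup d a (picard lam F a n) +
    dist_sup d (picard lam F a n) a <= fine S.
  by rewrite -lee_fin -SE.
have S0 : 0 <= fine S.
  by apply: le_trans (sum_le 0%N); rewrite addr_ge0 ?dist_sup_ge0.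
(* Adding [1] makes the bound strictly positive, as the later division by [M] requires. The index
   [0] is treated apart because [picard] starts at the first iterate. *)
exists (fine S + 1) => [|[|n]]; first by rewrite ltr_wpDl.
  have aa : dist_sup d a a <= fine S + 1.
    by apply: dist_sup_le => // i; rewrite distxx// addr_ge0.
  by split.
have le1 : fine S <= fine S + 1 by rewrite lerDl.
by split; apply: le_trans le1; apply: le_trans (sum_le n);
  rewrite ?lerDl ?lerDr dist_sup_ge0.
Qed.

Lemma picard_cauchy a : cauchy_seq (dist_sup d) (picard lam F a).
Proof.
have [M M0 aM] := iter_lambda_op_bounded a.
apply/cvgrPdist_lt => e e0.
(* Choose [N] with [k ^+ N * M < e]. *)
have /cvgrPdist_lt/(_ (e / M)) : k ^+ n @[n --> \oo] --> (0 : R).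
  by apply: cvg_expr; rewrite ger0_norm.
rewrite divr_gt0// => /(_ isT)[N _ /(_ N (leqnn N))].
rewrite /= sub0r normrN ger0_norm ?exprn_ge0// ltr_pdivlMr// => kN.
exists ([set n | (N <= n)%N], [set n | (N <= n)%N]).
  by split; exists N.
move=> [n p] [/= Nn Np]; rewrite sub0r normrN ger0_norm ?dist_sup_ge0//.
apply: le_lt_trans kN.
(* Write the later iterate as [iter u G] applied to [iter (v - u) G a]: the [u] common applications
   contract, and [M] bounds the rest. Both orders are recorded since [d] need not be symmetric. *)
have dist_le u v : (u <= v)%N ->
    dist_sup d (iter u G a) (iter v G a) <= k ^+ u * M /\
    dist_sup d (iter v G a) (iter u G a) <= k ^+ u * M.
  move=> uv; rewrite -(subnKC uv) iterD.
  by split; apply: le_trans (iter_lambda_op_contraction _ _ _) _;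
    rewrite ler_wpM2l ?exprn_ge0//; have [] := aM (v - u)%N.
(* The exponent is [u.+1] because [picard] at index [u] is the iterate of order [u.+1]. *)
have kle u : (N <= u)%N -> k ^+ u.+1 * M <= k ^+ N * M.
  move=> Nu; rewrite ler_wpM2r ?(ltW M0)// ler_wiXn2l// ?(ltW k1)//.
  exact: leqW.
by case/orP: (leq_total n p) => np; [apply: le_trans (kle n Nn)|
  apply: le_trans (kle p Np)]; have [] := dist_le _ _ (np : (_.+1 <= _.+1)%N).
Qed.

Hypotheses (hcomplete : complete_distance d) (hC : C_distance d).

Lemma picard_convergent a : convergent_seq (dist_sup d) (picard lam F a).
Proof.
have lim i : exists x, converges_to d (fun n => picard lam F a n i) x.
  by apply: hcomplete; apply: cauchy_seq_coord => //; exact: picard_cauchy.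
have [x xP] := choice lim.
exists (finfun x); apply: converges_to_dist_sup => // i.
by rewrite ffunE.
Qed.

Lemma picard_limit_fixed a b :
  converges_to (dist_sup d) (picard lam F a) b -> multiple_fixed_point lam F b.
Proof.
move=> ab.
have aGb : converges_to (dist_sup d) (picard lam F a) (G b).
  (* After a shift by one, each term is the distance from [G b] to [G] of the preceding iterate, at
     most [k] times a null sequence. *)
  rewrite /converges_to -(cvg_shiftS (fun n => dist_sup d (G b) _)) /=.
  have kab : k * dist_sup d b (picard lam F a n) @[n --> \oo] --> (0 : R).
    by rewrite -[0 in X in _ --> X](mulr0 k); apply: cvgMl_tmp.
  apply: (squeeze_cvgr _ (cvg_cst 0) kab); apply: nearW => n.
  by rewrite dist_sup_ge0//=; exact: lambda_op_contraction.
apply/ffunP => i.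
have abi := converges_to_coord hd i ab.
(* Uniqueness of limits is known in [X], so [b] and [G b] are compared one coordinate at a time. *)
have [c [_ c_uniq]] := hC (ex_intro _ _ abi)
  (cauchy_seq_coord hd i (picard_cauchy a)).
by rewrite -(c_uniq _ abi) (c_uniq _ (converges_to_coord hd i aGb)).
Qed.

End Picard.

(** Serves both halves of the theorem; averaged contractions reach it through
    [lambda_bar_contractionW]. *)
Lemma lambda_contraction_picard (R : realType) (m : nat) (hm : (0 < m)%N)
    (lam : 'I_m -> 'I_m -> 'I_m) (X : Type) (d : X -> X -> R)
    (hd : distance_space d) (hcomplete : complete_distance d)
    (hC : C_distance d) (F : {ffun 'I_m -> X} -> X)
    (hbounded : F_lambda_bounded d lam F) :
  lambda_contraction d F ->
  (forall a : {ffun 'I_m -> X},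
     convergent_seq (dist_sup d) (picard lam F a) /\
     cauchy_seq (dist_sup d) (picard lam F a)) /\
  exists! a : {ffun 'I_m -> X}, multiple_fixed_point lam F a.
Proof.
move=> [k [/andP[k0 k1] Fk]]; split=> [a|].
  split; first exact: (picard_convergent hm hd k0 k1).
  exact: (picard_cauchy hm hd k0 k1).
(* A point of [X] gives a constant tuple from which to start the iteration. *)
have [x0] := distance_inhabited hd.
have [b bP] := picard_convergent hm hd k0 k1 Fk hbounded hcomplete [ffun=> x0].
have Gb := picard_limit_fixed hm hd k0 k1 Fk hbounded hC bP.
exists b; split=> // c.
exact: (multiple_fixed_point_uniq hm hd k0 k1 Fk Gb).
Qed.

Theorem theorem4p3 (R : realType) (m : nat) (hm : (0 < m)%N)
    (lam : 'I_m -> 'I_m -> 'I_m) (X : Type) (d : X -> X -> R)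
    (hd : distance_space d) (hcomplete : complete_distance d)
    (hC : C_distance d) (F : {ffun 'I_m -> X} -> X)
    (hbounded : F_lambda_bounded d lam F) :
  (lambda_contraction d F ->
     (forall a : {ffun 'I_m -> X},
        convergent_seq (dist_sup d) (picard lam F a) /\
        cauchy_seq (dist_sup d) (picard lam F a)) /\
     exists! a : {ffun 'I_m -> X}, multiple_fixed_point lam F a) /\
  (lambda_bar_contraction d F ->
     (forall i : 'I_m,
        (forall j : 'I_m, exists l : 'I_m, lam i l = j) \/
        #|(\bigcup_(j < m) (lam i @^-1: [set j]))%SET| = m) ->
     (forall a : {ffun 'I_m -> X},
        convergent_seq (dist_sup d) (picard lam F a) /\
        cauchy_seq (dist_sup d) (picard lam F a)) /\
     exists! a : {ffun 'I_m -> X}, multiple_fixed_point lam F a).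
Proof.
split=> [|/(lambda_bar_contractionW hd hm) FC _];
  exact: lambda_contraction_picard.
Qed.
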